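(* Let $\mathbb A=\mathbb R[\varepsilon_1,\varepsilon_2]/(\varepsilon_1^2,\varepsilon_2^2)$ and let $p,q\in\mathbb R^3$ be linearly independent. Set $\phi=\varepsilon_1p+\varepsilon_2q\in\mathbb A^3$ and $Q=\operatorname{Exp}_{\mathbb A}([\phi]_\times)\in\mathrm{SO}(3,\mathbb A)$. Then there are no $\theta\in\mathbb A$ and $u\in\mathbb A^3$ such that $$u^Tu=1\quad\text{and}\quad Q=\operatorname{Exp}_{\mathbb A}(\theta\,[u]_\times).$$ The conclusion covers both the principal branch $\pi(\theta)=0$ and every nonprincipal branch $\pi(\theta)=2k\pi$, $k\in\mathbb Z\setminus\{0\}$ (here $\pi(\theta)$ is the scalar part of $\theta$, while $2k\pi$ is the real number).
   Context: The algebra $\mathbb A=\mathbb R[\varepsilon_1,\varepsilon_2]/(\varepsilon_1^2,\varepsilon_2^2)$ is a Weil algebra $\mathbb A=\mathbb R1_{\mathbb A}\oplus\mathfrak m$ with maximal ideal $\mathfrak m=(\varepsilon_1,\varepsilon_2)$ and nilpotency index $N=2$ ($\mathfrak m^{3}=0$, $\mathfrak m^2\ne0$). The scalar-part projection $\pi:\mathbb A\to\mathbb R$ is the algebra morphism with kernel $\mathfrak m$; it acts componentwise on $\mathbb A^p$. Finite Weil prolongation: for $f\in C^N(U,\mathbb R^q)$ with $U\subset\mathbb R^p$ open, $x\in U$, and $H\in\mathfrak m^p=\mathfrak m\times\cdots\times\mathfrak m$, $(J_{\mathbb A}f)(x+H)=\sum_{|\alpha|\le N}\frac1{\alpha!}(\partial^\alpha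 f)(x)H^\alpha\in\mathbb A^q$. $M_3(\mathbb A)$ is the algebra of $3\times3$ matrices over $\mathbb A$, and $\mathrm{SO}(3,\mathbb A)=\{Q\in M_3(\mathbb A):Q^TQ=I,\ \det Q=1\}$. $\operatorname{Exp}_{\mathbb A}:M_3(\mathbb A)\to M_3(\mathbb A)$ is the finite Weil prolongation $J_{\mathbb A}\exp$ of the real matrix exponential $\exp:M_3(\mathbb R)\to M_3(\mathbb R)$ (with $M_3(\mathbb R)\cong\mathbb R^9$). For $\phi=(\phi_1,\phi_2,\phi_3)^T\in\mathbb A^3$, $$[\phi]_\times=\begin{pmatrix}0&-\phi_3&\phi_2\\ \phi_3&0&-\phi_1\\ -\phi_2&\phi_1&0\end{pmatrix}.$$ *)

(* Defs.v *)
From HB Require Import structures.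
From mathcomp Require Import all_boot all_order all_algebra.
From mathcomp Require Import all_classical all_reals all_analysis.
(* The notations of mpoly clash with those of analysis. *)
From mathcomp Require Import -(notations) mpoly.

Set Implicit Arguments.
Unset Strict Implicit.
Unset Printing Implicit Defensive.

Import Order.TTheory GRing.Theory Num.Theory.
Import numFieldNormedType.Exports.

Local Open Scope classical_set_scope.
Local Open Scope ring_scope.

Definition X1 (R : comNzRingType) : mpoly 2 R := mpolyX R (mnm1 (ord0 : 'I_2)).
Definition X2 (R : comNzRingType) : mpoly 2 R :=
  mpolyX R (mnm1 (ord_max : 'I_2)).

Definition weil_ideal (R : comNzRingType) : {pred mpoly 2 R} :=
  fun P => `[< exists S T : mpoly 2 R, P = S * X1 R ^+ 2 + T * X2 R ^+ 2 >].
Arguments weil_ideal R : clear implicits.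

Lemma meval0_weil_ideal (R : comNzRingType) (P : mpoly 2 R) :
  P \in weil_ideal R -> meval (fun=> 0) P = 0.
Proof.
move=> /asboolP[S [T ->]].
by rewrite rmorphD !rmorphM /= !mevalXU !mulr0 addr0.
Qed.

Lemma weil_ideal_closed (R : comNzRingType) : idealr_closed (weil_ideal R).
Proof.
split.
- by apply/asboolP; exists 0, 0; rewrite !mul0r addr0.
- apply/negP => /meval0_weil_ideal /eqP; rewrite rmorph1.
  by rewrite oner_eq0.
- move=> a u v /asboolP[S [T ->]] /asboolP[S' [T' ->]].
  apply/asboolP; exists (a * S + S'), (a * T + T').
  by rewrite mulrDr !mulrDl !mulrA addrACA.
Qed.

HB.instance Definition _ (R : comNzRingType) :=
  isIdealr.Build (mpoly 2 R) (weil_ideal R) (@weil_ideal_closed R).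

Definition weil_alg (R : comNzRingType) : Type := {ideal_quot weil_ideal R}.

HB.instance Definition _ (R : comNzRingType) := GRing.ComNzRing.on (weil_alg R).

Definition weil_class (R : comNzRingType) (P : mpoly 2 R) : weil_alg R :=
  \pi_({ideal_quot weil_ideal R})%qT P.

Lemma weil_class_is_zmod_morphism (R : comNzRingType) :
  zmod_morphism (@weil_class R).
Proof. exact: raddfB. Qed.

Lemma weil_class_is_monoid_morphism (R : comNzRingType) :
  monoid_morphism (@weil_class R).
Proof. by split; [exact: rmorph1 | exact: rmorphM]. Qed.

HB.instance Definition _ (R : comNzRingType) :=
  GRing.isZmodMorphism.Build _ _ _ (@weil_class_is_zmod_morphism R).
HB.instance Definition _ (R : comNzRingType) :=
  GRing.isMonoidMorphism.Build _ _ _ (@weil_class_is_monoid_morphism R).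

Definition weil_scale (R : comNzRingType) (c : R) (a : weil_alg R)
  : weil_alg R := weil_class (mpolyC 2 c) * a.

Lemma weil_scaleA (R : comNzRingType) (b c : R) (a : weil_alg R) :
  weil_scale b (weil_scale c a) = weil_scale (b * c) a.
Proof. by rewrite /weil_scale mulrA -!rmorphM. Qed.

Lemma weil_scale1 (R : comNzRingType) : left_id 1 (@weil_scale R).
Proof. by move=> a; rewrite /weil_scale !rmorph1 mul1r. Qed.

Lemma weil_scaleDr (R : comNzRingType) :
  right_distributive (@weil_scale R) +%R.
Proof. by move=> c a b; exact: mulrDr. Qed.

Lemma weil_scaleDl (R : comNzRingType) (a : weil_alg R) :
  {morph (@weil_scale R)^~ a : b c / b + c}.
Proof. by move=> b c; rewrite /weil_scale !rmorphD mulrDl. Qed.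

HB.instance Definition _ (R : comNzRingType) :=
  GRing.Zmodule_isLmodule.Build R (weil_alg R)
    (@weil_scaleA R) (@weil_scale1 R) (@weil_scaleDr R) (@weil_scaleDl R).

Lemma weil_scaleAl (R : comNzRingType) (c : R) (a b : weil_alg R) :
  c *: (a * b) = (c *: a) * b.
Proof. exact: mulrA. Qed.

HB.instance Definition _ (R : comNzRingType) :=
  GRing.Lmodule_isLalgebra.Build R (weil_alg R) (@weil_scaleAl R).
HB.instance Definition _ (R : comNzRingType) :=
  GRing.Lalgebra_isComAlgebra.Build R (weil_alg R).

Definition eps1 (R : comNzRingType) : weil_alg R := weil_class (X1 R).
Definition eps2 (R : comNzRingType) : weil_alg R := weil_class (X2 R).

(* Every polynomial in weil_ideal vanishes at the origin, so the value at the
   origin of a representative depends only on its class: see scalar_part_class. *)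
Definition scalar_part (R : comNzRingType) (a : weil_alg R) : R :=
  meval (fun=> 0) (repr (a : {ideal_quot weil_ideal R})).

Lemma scalar_part_class (R : comNzRingType) (P : mpoly 2 R) :
  scalar_part (weil_class P) = meval (fun=> 0) P.
Proof.
apply/eqP; rewrite -subr_eq0 -rmorphB; apply/eqP/meval0_weil_ideal.
have /eqP := reprK (weil_class P : {ideal_quot weil_ideal R}).
by rewrite -Quotient.idealrBE.
Qed.

Lemma weil_classP (R : comNzRingType) (a : weil_alg R) :
  exists P, a = weil_class P.
Proof.
by exists (repr (a : {ideal_quot weil_ideal R})); rewrite /weil_class reprK.
Qed.

Lemma scalar_part_is_zmod_morphism (R : comNzRingType) :
  zmod_morphism (@scalar_part R).
Proof.
move=> a b; have [P ->] := weil_classP a; have [S ->] := weil_classP b.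
by rewrite -rmorphB !scalar_part_class rmorphB.
Qed.

Lemma scalar_part_is_monoid_morphism (R : comNzRingType) :
  monoid_morphism (@scalar_part R).
Proof.
split; first by rewrite -(rmorph1 (@weil_class R)) scalar_part_class rmorph1.
move=> a b; have [P ->] := weil_classP a; have [S ->] := weil_classP b.
by rewrite -rmorphM !scalar_part_class rmorphM.
Qed.

HB.instance Definition _ (R : comNzRingType) :=
  GRing.isZmodMorphism.Build _ _ _ (@scalar_part_is_zmod_morphism R).
HB.instance Definition _ (R : comNzRingType) :=
  GRing.isMonoidMorphism.Build _ _ _ (@scalar_part_is_monoid_morphism R).

Lemma scalar_part_scalable (R : comNzRingType) :
  scalable_for *%R (@scalar_part R).
Proof.
move=> c a; rewrite [c *: a]/(weil_class (mpolyC 2 c) * a) rmorphM /=.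
by rewrite scalar_part_class mevalC.
Qed.

HB.instance Definition _ (R : comNzRingType) :=
  GRing.isScalable.Build _ _ _ _ _ (@scalar_part_scalable R).

Definition pderiv (R : realType) (m n : nat) (i : 'I_m)
    (f : 'rV[R]_m -> 'rV[R]_n) : 'rV[R]_m -> 'rV[R]_n :=
  fun x => 'D_(delta_mx 0 i) f x.

(* d^alpha f = d_0 ^ alpha_0 ( ... (d_(m-1) ^ alpha_(m-1) f)) *)
Definition mpderiv (R : realType) (m n : nat) (alpha : 'I_m -> nat)
    (f : 'rV[R]_m -> 'rV[R]_n) : 'rV[R]_m -> 'rV[R]_n :=
  foldr (fun i g => iter (alpha i) (pderiv i) g) f (enum 'I_m).

(* The argument a is uniquely x + H with x the real point of its scalar parts
   and H nilpotent. The multi-indices alpha with |alpha| <= N have entries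
   at most N, hence the summation over {ffun 'I_m -> 'I_N.+1}. *)
Definition weil_prolong (R : realType) (A : comAlgType R) (pi : A -> R)
    (N m n : nat) (f : 'rV[R]_m -> 'rV[R]_n) (a : 'rV[A]_m) : 'rV[A]_n :=
  let x : 'rV[R]_m := map_mx pi a in
  let H : 'rV[A]_m := a - map_mx (in_alg A) x in
  \sum_(alpha : {ffun 'I_m -> 'I_N.+1} | (\sum_i alpha i <= N)%N)
    (\prod_i H 0 i ^+ alpha i) *:
      map_mx (in_alg A) ((\prod_i (alpha i)`!)%:R^-1 *: mpderiv (fun i => alpha i) f x).

Definition expmx (R : realType) (n : nat) (M : 'M[R]_n) : 'M[R]_n :=
  limn (series (fun k : nat => k`!%:R^-1 *: M ^+ k)).

(* mxvec is the identification of M_3 with 9-dimensional row vectors, and 2 is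
   the nilpotency index of weil_alg R. *)
Definition Exp_weil (R : realType) (M : 'M[weil_alg R]_3) : 'M[weil_alg R]_3 :=
  vec_mx (weil_prolong (@scalar_part R) 2
            (fun x : 'rV[R]_(3 * 3) => mxvec (expmx (vec_mx x))) (mxvec M)).

Definition SO3 (A : comNzRingType) : set 'M[A]_3 :=
  [set Q | Q^T *m Q = 1%:M /\ \det Q = 1].
Arguments SO3 A : clear implicits.

Definition cross_mx (A : comNzRingType) (phi : 'cV[A]_3) : 'M[A]_3 :=
  let f k := phi (inord k) 0 in
  \matrix_(i < 3, j < 3)
    nth 0 (nth [::] [:: [:: 0; - f 2%N; f 1%N];
                        [:: f 2%N; 0; - f 0%N];
                        [:: - f 1%N; f 0%N; 0]] i) j.

(* Main.v *)
(** Modulo the square of the maximal ideal, the prolongation of [expmx] at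
    [x + H] is [expmx x + L_x(H)], where [L_x] is the derivative of [expmx] at
    [x].  Suppose [Exp_weil (theta *: [u]) = Exp_weil [phi]], and let [X] be the
    scalar part of [theta *: [u]]; then [expmx X = 1].  The eps_i-coefficient
    of [theta *: [u]] is [dtheta *: [u0] + theta0 *: [w]] with [w] orthogonal
    to the unit vector [u0], since [u^T u = 1].  As [u0 x (v x u0) = v] for
    [v] orthogonal to [u0], [theta0 *: [w]] is a commutator [X V - V X], on
    which [L_X] takes the value [expmx X V - V expmx X = 0].  Hence [p] and [q]
    are both multiples of the single matrix [L_X [u0]], on every branch of the
    angle at once.  Membership in SO(3) comes from
    [Exp_weil [phi] = 1 + [phi] + [phi]^2 / 2] and [phi_i phi_j phi_k = 0]. *)
From HB Require Import structures.
Require Import Defs.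
From mathcomp Require Import all_boot all_order all_algebra.
From mathcomp Require Import all_classical all_reals all_analysis.
From mathcomp Require Import -(notations) mpoly.
From mathcomp Require Import ring lra.
Import Order.TTheory GRing.Theory Num.Theory numFieldNormedType.Exports.
Local Open Scope classical_set_scope.
Local Open Scope ring_scope.
Set Implicit Arguments.
Unset Strict Implicit.
Unset Printing Implicit Defensive.

(* Makes matrices a completeNormedModType, which is not inferred otherwise. *)
HB.instance Definition _ (R : realType) m n := Complete.on 'M[R]_(m, n).

(** * The entrywise sup norm on matrices *)

Lemma mx_norm_le (R : realType) m n (A : 'M[R]_(m, n)) (C : R) :
  0 <= C -> (forall i j, `|A i j| <= C) -> `|A| <= C.
Proof.
by move=> C0 AC; rewrite /Num.norm/= mx_normrE; apply: bigmax_le => // -[i j] _.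
Qed.

Lemma le_mx_norm (R : realType) m n (A : 'M[R]_(m, n)) i j : `|A i j| <= `|A|.
Proof.
rewrite [leRHS]/Num.norm/= mx_normrE.
exact: (le_bigmax _ (fun ij => `|A ij.1 ij.2|) (i, j)).
Qed.

Lemma mx_norm_mul (R : realType) m n p (A : 'M[R]_(m, n)) (B : 'M[R]_(n, p)) :
  `|A *m B| <= n%:R * `|A| * `|B|.
Proof.
apply: mx_norm_le => [|i j]; first by rewrite !mulr_ge0.
rewrite mxE (le_trans (ler_norm_sum _ _ _))//.
rewrite -mulrA mulr_natl -[X in _ *+ X]card_ord -sumr_const.
by apply: ler_sum => k _; rewrite normrM ler_pM ?le_mx_norm.
Qed.

Lemma mx_norm_mxvec (R : realType) m n (A : 'M[R]_(m, n)) : `|mxvec A| <= `|A|.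
Proof.
apply: mx_norm_le => // i j; case/mxvec_indexP: j => k l.
by rewrite (ord1 i) mxvecE le_mx_norm.
Qed.

(* Exponential generating series: expmx x is egf (GRing.exp x). *)
Definition egf (R : realType) m n (a : nat -> 'M[R]_(m, n)) : 'M[R]_(m, n) :=
  limn (series (fun k => k`!%:R^-1 *: a k)).

(** * Convergence and norm bounds for exponential generating series *)

Section egf.
Variables (R : realType) (m n : nat).
Implicit Types (a b : nat -> 'M[R]_(m, n)) (K C : R).

Lemma norm_egf_term_le a K C k : `|a k| <= K * C ^+ k ->
  `|k`!%:R^-1 *: a k| <= K * exp_coeff C k.
Proof.
move=> aC; rewrite normrZ ger0_norm ?invr_ge0 ?ler0n// /exp_coeff /= mulrA.
by rewrite mulrC ler_wpM2r// invr_ge0.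
Qed.

Lemma is_cvg_egf_normed a K C : 0 <= K -> 0 <= C ->
  (forall k, `|a k| <= K * C ^+ k) ->
  cvgn [normed series (fun k => k`!%:R^-1 *: a k)].
Proof.
move=> K0 C0 aC.
apply: (@series_le_cvg _ _ (fun k => K * exp_coeff C k)) => [k|k|k|] /=.
- by [].
- by rewrite mulr_ge0// exp_coeff_ge0.
- exact: norm_egf_term_le.
- by apply: is_cvg_seriesZ; exact: is_cvg_series_exp_coeff.
Qed.

Lemma is_cvg_egf a K C : 0 <= K -> 0 <= C ->
  (forall k, `|a k| <= K * C ^+ k) ->
  cvgn (series (fun k => k`!%:R^-1 *: a k)).
Proof. by move=> K0 C0 aC; apply: normed_cvg; exact: is_cvg_egf_normed aC. Qed.

Lemma norm_egf_le a K C : 0 <= K -> 0 <= C ->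
  (forall k, `|a k| <= K * C ^+ k) -> `|egf a| <= K * expR C.
Proof.
move=> K0 C0 aC.
rewrite -lim_norm; last exact: is_cvg_egf aC.
have -> : K * expR C = limn (series (fun k => K * exp_coeff C k)).
  by rewrite lim_seriesZ//; exact: is_cvg_series_exp_coeff.
apply: ler_lim.
- by apply: is_cvg_norm; exact: is_cvg_egf aC.
- by apply: is_cvg_seriesZ; exact: is_cvg_series_exp_coeff.
- apply: nearW => N; rewrite /series/=.
  by rewrite (le_trans (ler_norm_sum _ _ _))// ler_sum// => k _; exact: norm_egf_term_le.
Qed.

End egf.

(** The exponent [k.+1] and the condition [1 <= C] let one constant serve as both prefactor and
    ratio. A factor c >= 0 is absorbed into the base, because c <= (c + 1) ^ (k + 1), so the class
    is stable under sums, scalings and multiplication by a fixed matrix. *)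
Definition geometric_bound (R : realType) m n (a : nat -> 'M[R]_(m, n)) :=
  exists2 C : R, 1 <= C & forall k, `|a k| <= C ^+ k.+1.

Section egf_linear.
Variables (R : realType) (m n : nat).
Implicit Types (a b : nat -> 'M[R]_(m, n)).

Lemma geometric_bound_cvg a : geometric_bound a ->
  cvgn (series (fun k => k`!%:R^-1 *: a k)).
Proof.
move=> [C C1 aC]; have C0 : 0 <= C by apply: le_trans C1.
by apply: (is_cvg_egf C0 C0) => k; rewrite -exprS.
Qed.

Lemma egfD a b : geometric_bound a -> geometric_bound b ->
  egf (fun k => a k + b k) = egf a + egf b.
Proof.
move=> /geometric_bound_cvg ca /geometric_bound_cvg cb.
rewrite /egf -limD//; congr (limn _).
apply/funext => N; rewrite /series/= fctE -big_split /=.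
by apply: eq_bigr => k _; rewrite scalerDr.
Qed.

Lemma egfZ a (c : R) : geometric_bound a -> egf (fun k => c *: a k) = c *: egf a.
Proof.
move=> /geometric_bound_cvg ca.
rewrite /egf -limZr//; congr (limn _).
apply/funext => N; rewrite /series/= fctE scaler_sumr.
by apply: eq_bigr => k _; rewrite !scalerA mulrC.
Qed.

Lemma sum_exprS_le (C D : R) k : 0 <= C -> 0 <= D ->
  C ^+ k.+1 + D ^+ k.+1 <= (C + D) ^+ k.+1.
Proof.
move=> C0 D0; rewrite !exprS mulrDl.
by apply: lerD; apply: ler_wpM2l => //; apply: lerXn2r; rewrite ?nnegrE ?addr_ge0 ?lerDl ?lerDr.
Qed.

Lemma geometric_boundD a b : geometric_bound a -> geometric_bound b ->
  geometric_bound (fun k => a k + b k).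
Proof.
move=> [C C1 aC] [D D1 bD]; exists (C + D); first by lra.
move=> k; rewrite (le_trans (ler_normD _ _))//.
by rewrite (le_trans (lerD (aC k) (bD k)))// sum_exprS_le//; lra.
Qed.

Lemma geometric_boundZ a (c : R) : geometric_bound a ->
  geometric_bound (fun k => c *: a k).
Proof.
move=> [C C1 aC]; have c0 := normr_ge0 c; exists ((`|c| + 1) * C); first by nra.
move=> k; rewrite normrZ exprMn ler_pM//.
by rewrite (@le_trans _ _ (`|c| + 1)) ?lerDl// ler_eXnr//; lra.
Qed.

Lemma egf_finite a N : (forall k, (N <= k)%N -> a k = 0) ->
  egf a = \sum_(k < N) k`!%:R^-1 *: a k.
Proof.
move=> a0; apply/(@cvg_lim _ _ _) => //.
rewrite -(cvg_shiftn N).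
apply: cvg_near_cst; apply: nearW => M; rewrite /series/=.
rewrite (big_cat_nat (n := N))//= ?leq_addl// big_mkord [X in _ + X]big1_seq ?addr0//.
by move=> k; rewrite mem_index_iota => /andP[_ /andP[/a0 -> _]]; rewrite scaler0.
Qed.

End egf_linear.

Lemma egf_raddf (R : realType) m n p q
    (g : {linear 'M[R]_(m, n) -> 'M[R]_(p, q)}) (C : R) a :
  (forall A, `|g A| <= C * `|A|) -> geometric_bound a ->
  egf (fun k => g (a k)) = g (egf a).
Proof.
move=> gC /geometric_bound_cvg ca; apply/(@cvg_lim _ _ _) => //.
have cg : continuous g.
  apply/linear_bounded_continuous/linear_boundedP; near=> r => A.
  by rewrite (le_trans (gC A))// ler_wpM2r//; near: r; exact: nbhs_pinfty_ge.
have -> : series (fun k => k`!%:R^-1 *: g (a k)) =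
   g \o series (fun k => k`!%:R^-1 *: a k).
  by apply/funext => N; rewrite /series/= linear_sum; apply: eq_bigr => k _; rewrite linearZ.
by apply: continuous_cvg => //; exact: cg.
Unshelve. all: by end_near. Qed.

(* The powers of x and their first and second directional derivatives all obey
   a recurrence of this shape, so one remainder estimate serves for both orders. *)
Fixpoint mxrec (R : realType) n (x : 'M[R]_n) (x0 : 'M[R]_n) (b : nat -> 'M[R]_n)
    (k : nat) : 'M[R]_n :=
  if k is l.+1 then x *m mxrec x x0 b l + b l else x0.

(** [a'] is the derivative at t = 0 of the family [f]. The remainder is quadratic in t, uniformly on
    |t| <= 1, and grows only geometrically in k, so it stays quadratic after division by k! and
    summation. *)
Definition expansion (R : realType) m n (f : R -> nat -> 'M[R]_(m, n)) a a' :=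
  exists2 C : R, 1 <= C &
    forall t k, `|t| <= 1 -> `|f t k - (a k + t *: a' k)| <= t ^+ 2 * C ^+ k.+1.

(** * Growth and first-order expansion of linear matrix recurrences *)

Section recurrence.
Variables (R : realType) (n : nat).
Implicit Types (x E F : 'M[R]_n) (a b : nat -> 'M[R]_n).

Lemma geometric_boundM E b : geometric_bound b ->
  geometric_bound (fun k => E *m b k).
Proof.
move=> [C C1 bC]; set e := n%:R * `|E|.
have e0 : 0 <= e by rewrite /e mulr_ge0.
exists ((e + 1) * C); first by nra.
move=> k; rewrite (le_trans (mx_norm_mul _ _))// exprMn ler_pM//.
by rewrite (@le_trans _ _ (e + 1)) ?lerDl// ler_eXnr//; lra.
Qed.

Lemma geometric_bound_mxrec x x0 b : geometric_bound b ->
  geometric_bound (mxrec x x0 b).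
Proof.
move=> [C C1 bC]; set e := n%:R * `|x|.
have e0 : 0 <= e by rewrite /e mulr_ge0.
have x00 := normr_ge0 x0.
(* [B] bounds the initial value [x0] and the base [C] of the inhomogeneous term, and B >= e + 1 pays
   for one step of the recurrence. *)
set B := 1 + e + C + `|x0|; have B0 : 0 <= B by rewrite /B; lra.
exists B; first by rewrite /B; lra.
elim=> [|k IH] /=; first by rewrite expr1 /B; lra.
have BS : 0 <= B ^+ k.+1 by exact: exprn_ge0.
rewrite (le_trans (ler_normD _ _))// [leRHS]exprS.
apply: (@le_trans _ _ (e * B ^+ k.+1 + B ^+ k.+1)).
  apply: lerD; first by rewrite (le_trans (mx_norm_mul _ _))// ler_wpM2l.
  by rewrite (le_trans (bC k))// lerXn2r// ?nnegrE /B; lra.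
by rewrite -[X in _ + X]mul1r -mulrDl ler_wpM2r// /B; lra.
Qed.

Lemma expansion_cst (a : nat -> 'M[R]_n) : expansion (fun=> a) a (fun=> 0).
Proof.
exists 1 => // t k _; rewrite scaler0 addr0 subrr normr0.
by rewrite expr1n mulr1 sqr_ge0.
Qed.

Lemma expansionM E g b b' : expansion g b b' ->
  expansion (fun t k => E *m g t k) (fun k => E *m b k) (fun k => E *m b' k).
Proof.
move=> [C C1 gC]; set e := n%:R * `|E|.
have e0 : 0 <= e by rewrite /e mulr_ge0.
exists ((e + 1) * C); first by nra.
move=> t k t1; rewrite scalemxAr -mulmxDr -mulmxBr.
rewrite (le_trans (mx_norm_mul _ _))// exprMn mulrCA ler_pM//; last exact: gC.
by rewrite (@le_trans _ _ (e + 1)) ?lerDl// ler_eXnr//; lra.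
Qed.

(** Differentiating f (k+1) = (x + t F) f k + g k at t = 0 gives a' (k+1) = x a' k + (F a k + b' k).
    The derivative starts at 0 because [x0] does not depend on t. *)
Lemma mxrec_expansion x F x0 b b' g :
  geometric_bound b -> geometric_bound b' -> expansion g b b' ->
  expansion (fun t => mxrec (x + t *: F) x0 (g t)) (mxrec x x0 b)
    (mxrec x 0 (fun k => F *m mxrec x x0 b k + b' k)).
Proof.
move=> bb bb' [C2 C21 gC].
set a := mxrec x x0 b; set a' := mxrec x 0 _.
have [C1 C11 aC] : geometric_bound a'.
  apply: geometric_bound_mxrec; apply: geometric_boundD => //.
  by apply: geometric_boundM; exact: geometric_bound_mxrec.
set e := n%:R * `|x|; set h := n%:R * `|F|.
have e0 : 0 <= e by rewrite /e mulr_ge0.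
have h0 : 0 <= h by rewrite /h mulr_ge0.
(* B >= e + h + h + 1 is the factor by which the remainder may grow in one step; [C1] and [C2] bound
   the sequences that feed it. *)
set B := C1 + C2 + e + h + h + 1.
have B0 : 0 <= B by rewrite /B; lra.
exists B; first by rewrite /B; lra.
move=> t k t1; have t20 := sqr_ge0 t.
elim: k => [|k IH].
  by rewrite /= scaler0 addr0 subrr normr0 mulr_ge0// exprn_ge0.
have BS : 0 <= B ^+ k.+1 by exact: exprn_ge0.
rewrite /= -/a -/a'.
set f := mxrec (x + t *: F) x0 (g t) in IH *.
(* The new remainder consists of the previous one multiplied by x + t F, the second-order cross term
   t^2 F a', and the remainder of [g]. *)
have -> : (x + t *: F) *m f k + g t k
   - (x *m a k + b k + t *: (x *m a' k + (F *m a k + b' k))) =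
   (x + t *: F) *m (f k - (a k + t *: a' k)) + t ^+ 2 *: (F *m a' k)
   + (g t k - (b k + t *: b' k)).
  rewrite mulmxBr mulmxDr !mulmxDl !scalerDr -!scalemxAr -!scalemxAl scalerA -expr2.
  move: (x *m f k) (t *: (F *m f k)) (x *m a k) (t *: (F *m a k)) (t *: (x *m a' k)).
  move: (t ^+ 2 *: (F *m a' k)) (t *: b' k) (b k) (g t k) => a1 a2 a3 a4 a5 a6 a7 a8 a9.
  apply/matrixP => i j; rewrite !mxE; ring.
rewrite (le_trans (ler_normD _ _))// (le_trans (lerD (ler_normD _ _) (lexx _)))//.
rewrite [X in _ * X]exprS.
apply: (@le_trans _ _ ((e + h) * (t ^+ 2 * B ^+ k.+1)
   + t ^+ 2 * (h * B ^+ k.+1) + t ^+ 2 * B ^+ k.+1)).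
  apply: lerD; first apply: lerD.
  - rewrite (le_trans (mx_norm_mul _ _))//; apply: ler_pM => //.
    rewrite -mulrDr ler_wpM2l// (le_trans (ler_normD _ _))// lerD2l normrZ.
    by rewrite ler_piMl.
  - rewrite normrZ ger0_norm// ler_wpM2l// (le_trans (mx_norm_mul _ _))//.
    rewrite ler_wpM2l// (le_trans (aC k))// lerXn2r// ?nnegrE /B; lra.
  - rewrite (le_trans (gC t k t1))// ler_wpM2l// lerXn2r// ?nnegrE /B; lra.
have -> : (e + h) * (t ^+ 2 * B ^+ k.+1) + t ^+ 2 * (h * B ^+ k.+1)
   + t ^+ 2 * B ^+ k.+1 = t ^+ 2 * ((e + h + h + 1) * B ^+ k.+1) by ring.
by rewrite ler_wpM2l// ler_wpM2r// /B; lra.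
Qed.

End recurrence.

(** * From termwise expansions to directional derivatives *)

Lemma expansion_egf_le (R : realType) m n (f : R -> nat -> 'M[R]_(m, n)) a a' :
  (forall t, geometric_bound (f t)) ->
  geometric_bound a -> geometric_bound a' -> expansion f a a' ->
  exists C : R, forall t, `|t| <= 1 ->
    `|egf (f t) - (egf a + t *: egf a')| <= t ^+ 2 * C.
Proof.
move=> fb ab a'b [C C1 fC]; have C0 : 0 <= C by lra.
(* The remainders t^2 C C^k, weighted by 1/k!, sum to t^2 C exp C. *)
exists (C * expR C) => t t1.
have ta := geometric_boundZ t a'b.
have aa := geometric_boundD ab ta.
rewrite -egfZ// -egfD// -scaleN1r -egfZ// -egfD//; last exact: geometric_boundZ.
rewrite mulrA; apply: norm_egf_le => //; first by rewrite mulr_ge0// sqr_ge0.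
by move=> k; rewrite -mulrA -exprS scaleN1r; exact: fC.
Qed.

Lemma derive_expansion (R : realType) (V W : normedModType R) (Phi : V -> W) a v l C :
  (forall t : R, `|t| <= 1 -> `|Phi (t *: v + a) - (Phi a + t *: l)| <= t ^+ 2 * C) ->
  'D_v Phi a = l.
Proof.
move=> PhiC; apply/(@cvg_lim _ _ _) => //.
apply/cvgrPdist_le => e e0.
(* The hypothesis at t = 1 bounds a norm by [C]. *)
have C0 : 0 <= C.
  by have := PhiC 1; rewrite normr1 lexx expr1n mul1r => /(_ isT); exact: le_trans.
near=> t.
have t0 : t != 0 by near: t; exact: nbhs_dnbhs_neq.
have tP : 0 < `|t| by rewrite normr_gt0.
have t1 : `|t| <= 1.
  near: t; apply: dnbhs0_le; exact: ltr01.
(* [C + 1] rather than [C], which may be 0. *)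
have te : `|t| <= e / (C + 1).
  near: t; apply: dnbhs0_le; rewrite divr_gt0//; lra.
rewrite /= distrC -(ler_pM2l tP) -normrZ.
have -> : t *: (t^-1 *: (Phi (t *: v + a) - Phi a) - l) =
    Phi (t *: v + a) - (Phi a + t *: l).
  by rewrite scalerBr scalerA divff// scale1r opprD addrA.
rewrite (le_trans (PhiC t t1))// -real_normK ?num_real// expr2 -mulrA ler_wpM2l//.
move: te; rewrite ler_pdivlMr; last by lra.
by apply: le_trans; rewrite ler_wpM2l//; lra.
Unshelve. all: by end_near. Qed.

Lemma norm_mxvec_affine_le (R : realType) m n (A B C : 'M[R]_(m, n)) (t : R) :
  `|mxvec A - (mxvec B + t *: mxvec C)| <= `|A - (B + t *: C)|.
Proof.
have -> : mxvec A - (mxvec B + t *: mxvec C) = mxvec (A - (B + t *: C)).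
  by rewrite [RHS]raddfB; congr (_ - _); rewrite [RHS]raddfD; congr (_ + _); rewrite [RHS]linearZ.
exact: mx_norm_mxvec.
Qed.

(** * First and second derivatives of the matrix exponential *)

Section exponential.
Variables (R : realType) (n : nat).
Implicit Types x E F : 'M[R]_n.

(* Directional derivatives of x |-> x ^+ k, from (x^(k+1))' = x (x^k)' + E x^k. *)
Definition dpow x E := mxrec x 0 (fun k => E *m x ^+ k).
Definition ddpow x E F := mxrec x 0 (fun k => F *m dpow x E k + E *m dpow x F k).
Lemma dpowS x E k : dpow x E k.+1 = x *m dpow x E k + E *m x ^+ k.
Proof. by []. Qed.

Lemma ddpowS x E F k :
  ddpow x E F k.+1 = x *m ddpow x E F k + (F *m dpow x E k + E *m dpow x F k).
Proof. by []. Qed.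

(** Termwise derivatives of the exponential series; [derive_expmx] and [derive_dexpmx] identify them
    with the true directional derivatives. *)
Definition dexpmx x E := egf (dpow x E).
Definition ddexpmx x E F := egf (ddpow x E F).

Lemma mxrec_expn x : mxrec x 1%:M (fun=> 0) = GRing.exp x.
Proof.
apply/funext; elim=> [|k IH]; first by rewrite expr0.
by rewrite /= IH addr0 exprS.
Qed.

Lemma geometric_bound0 : geometric_bound (fun=> 0 : 'M[R]_n).
Proof. by exists 1 => // k; rewrite normr0 expr1n. Qed.

Lemma geometric_bound_expn x : geometric_bound (GRing.exp x).
Proof. by rewrite -mxrec_expn; apply: geometric_bound_mxrec; exact: geometric_bound0. Qed.

Lemma geometric_bound_dpow x E : geometric_bound (dpow x E).
Proof. by apply/geometric_bound_mxrec/geometric_boundM/geometric_bound_expn. Qed.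

Lemma geometric_bound_ddpow x E F : geometric_bound (ddpow x E F).
Proof.
by apply/geometric_bound_mxrec/geometric_boundD; apply/geometric_boundM/geometric_bound_dpow.
Qed.

Lemma expansion_expn x E :
  expansion (fun t : R => GRing.exp (x + t *: E)) (GRing.exp x) (dpow x E).
Proof.
rewrite (_ : (fun t => _) = fun t : R => mxrec (x + t *: E) 1%:M (fun=> 0)); last first.
  by apply/funext => t; rewrite mxrec_expn.
rewrite (_ : dpow x E = mxrec x 0 (fun k => E *m mxrec x 1%:M (fun=> 0) k + 0)).
  rewrite -mxrec_expn.
  apply: mxrec_expansion (expansion_cst _); exact: geometric_bound0.
by rewrite /dpow mxrec_expn; congr mxrec; apply/funext => k; rewrite addr0.
Qed.

Lemma expansion_dpow x E F :
  expansion (fun t : R => dpow (x + t *: F) E) (dpow x E) (ddpow x E F).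
Proof.
apply: mxrec_expansion.
- exact/geometric_boundM/geometric_bound_expn.
- exact/geometric_boundM/geometric_bound_dpow.
- exact/expansionM/expansion_expn.
Qed.

Lemma derive_expmx (y v : 'rV[R]_(n * n)) :
  'D_v (fun y => mxvec (expmx (vec_mx y))) y = mxvec (dexpmx (vec_mx y) (vec_mx v)).
Proof.
have [C HC] := expansion_egf_le (fun t : R => geometric_bound_expn (vec_mx y + t *: vec_mx v))
  (geometric_bound_expn _) (geometric_bound_dpow _ _) (expansion_expn (vec_mx y) (vec_mx v)).
apply: (derive_expansion (C := C)) => t t1.
rewrite [vec_mx (_ + _)](_ : _ = vec_mx y + t *: vec_mx v); last by rewrite linearD linearZ addrC.
by rewrite (le_trans (norm_mxvec_affine_le _ _ _ _))//; exact: HC.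
Qed.

Lemma derive_dexpmx E (y v : 'rV[R]_(n * n)) :
  'D_v (fun y => mxvec (dexpmx (vec_mx y) E)) y
  = mxvec (ddexpmx (vec_mx y) E (vec_mx v)).
Proof.
have [C HC] := expansion_egf_le (fun t : R => geometric_bound_dpow (vec_mx y + t *: vec_mx v) E)
  (geometric_bound_dpow _ _) (geometric_bound_ddpow _ _ _)
  (expansion_dpow (vec_mx y) E (vec_mx v)).
apply: (derive_expansion (C := C)) => t t1.
rewrite [vec_mx (_ + _)](_ : _ = vec_mx y + t *: vec_mx v); last by rewrite linearD linearZ addrC.
by rewrite (le_trans (norm_mxvec_affine_le _ _ _ _))//; exact: HC.
Qed.

(** The recurrence defining [ddpow] is symmetric in [E] and [F]. This yields the equality of mixed
    partial derivatives that [weil_prolong2E] requires. *)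
Lemma ddexpmxC x E F : ddexpmx x E F = ddexpmx x F E.
Proof.
by rewrite /ddexpmx /ddpow; congr (egf (mxrec _ _ _)); apply/funext => k; rewrite addrC.
Qed.

Lemma dexpmxD x E F : dexpmx x (E + F) = dexpmx x E + dexpmx x F.
Proof.
rewrite /dexpmx -egfD; try exact: geometric_bound_dpow.
congr egf; apply/funext; elim=> [|k IH]; first by rewrite addr0.
by rewrite !dpowS IH mulmxDr mulmxDl addrACA.
Qed.

Lemma dexpmxZ x c E : dexpmx x (c *: E) = c *: dexpmx x E.
Proof.
rewrite /dexpmx -egfZ; last exact: geometric_bound_dpow.
congr egf; apply/funext; elim=> [|k IH]; first by rewrite scaler0.
by rewrite !dpowS IH -scalemxAr -scalemxAl scalerDr.
Qed.

(** Infinitesimal form of the equivariance of exp under conjugation. It holds power by power: the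
    derivative of x^k along x V - V x telescopes to x^k V - V x^k. *)
Lemma dexpmx_comm x V :
  dexpmx x (x *m V - V *m x) = expmx x *m V - V *m expmx x.
Proof.
have bL W := geometric_boundM W (geometric_bound_expn x).
have -> : expmx x *m V = egf (fun k => x ^+ k *m V).
  rewrite [RHS](egf_raddf (g := mulmxr V) (C := n%:R * `|V|))//; last exact: geometric_bound_expn.
  by move=> A; rewrite (le_trans (mx_norm_mul _ _))// mulrAC.
have -> : V *m expmx x = egf (fun k => V *m x ^+ k).
  rewrite [RHS](egf_raddf (g := mulmx V) (C := n%:R * `|V|))//; last exact: geometric_bound_expn.
  by move=> A; rewrite (le_trans (mx_norm_mul _ _)).
have bR : geometric_bound (fun k => x ^+ k *m V).
  rewrite (_ : (fun k => _) = mxrec x V (fun=> 0)); last first.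
    apply/funext; elim=> [|k IH]; first by rewrite expr0 mul1mx.
    by rewrite /= addr0 -IH exprS -mulmxE mulmxA.
  by apply: geometric_bound_mxrec; exact: geometric_bound0.
rewrite -[- egf _]scaleN1r -egfZ// -egfD//; last exact: geometric_boundZ.
congr egf; apply/funext; elim=> [|k IH].
  by rewrite expr0 mulmx1 mul1mx scaleN1r subrr.
rewrite dpowS IH !scaleN1r exprS !mulmxBr !mulmxBl -!mulmxE !mulmxA.
by rewrite addrA subrK.
Qed.

End exponential.

(** * The exponential and its derivatives at 0, where the series are finite *)

Lemma expmx0 (R : realType) n : expmx (0 : 'M[R]_n) = 1%:M.
Proof.
rewrite -[LHS]/(egf (GRing.exp (0 : 'M[R]_n))) (egf_finite (N := 1)).
  by rewrite big_ord1 fact0 invr1 scale1r.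
by case=> // k _; rewrite expr0n.
Qed.

Lemma dpow0 (R : realType) n (E : 'M[R]_n) k : dpow 0 E k = if k == 1%N then E else 0.
Proof.
case: k => [|k] //; rewrite dpowS mul0mx add0r expr0n eqSS.
by case: k => [|k]; rewrite ?mulmx1 ?mulmx0.
Qed.

Lemma dexpmx0 (R : realType) n (E : 'M[R]_n) : dexpmx 0 E = E.
Proof.
rewrite /dexpmx (egf_finite (N := 2)); last by case=> [|[|k]] // _; rewrite dpow0.
by rewrite 2!big_ord_recr big_ord0 /= !dpow0 /= scaler0 !add0r invr1 scale1r.
Qed.

Lemma ddpow0 (R : realType) n (E F : 'M[R]_n) k :
  ddpow 0 E F k = if k == 2%N then F *m E + E *m F else 0.
Proof.
case: k => [|k] //; rewrite ddpowS mul0mx add0r !dpow0 eqSS.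
by case: ifP; rewrite ?mulmx0 ?addr0.
Qed.

Lemma ddexpmx0 (R : realType) n (E F : 'M[R]_n) :
  ddexpmx 0 E F = 2^-1 *: (F *m E + E *m F).
Proof.
rewrite /ddexpmx (egf_finite (N := 3)); last by case=> [|[|[|k]]] // _; rewrite ddpow0.
by rewrite 3!big_ord_recr big_ord0 /= !ddpow0 /= !scaler0 !add0r.
Qed.

(** * Multi-indices of degree at most two and the prolongation of order two *)

(** Unrolling a multi-index into a list of directions turns its degree into a length and its entries
    into counts, so degrees one and two become case analyses on a short list. *)
Lemma mpderivE (R : realType) m n (alpha : 'I_m -> nat) (f : 'rV[R]_m -> 'rV[R]_n) :
  mpderiv alpha f =
    foldr (fun i g => pderiv i g) f (flatten [seq nseq (alpha i) i | i <- enum 'I_m]).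
Proof.
rewrite /mpderiv; elim: (enum 'I_m) => //= i s ->.
by rewrite foldr_cat; elim: (alpha i) => //= k ->.
Qed.

Lemma size_multiindex m (alpha : 'I_m -> nat) :
  size (flatten [seq nseq (alpha i) i | i <- enum 'I_m]) = (\sum_i alpha i)%N.
Proof.
rewrite size_flatten sumnE /shape -map_comp big_map big_enum /=.
by apply: eq_bigr => i _; rewrite size_nseq.
Qed.

Lemma count_multiindex m (alpha : 'I_m -> nat) i :
  count_mem i (flatten [seq nseq (alpha i) i | i <- enum 'I_m]) = alpha i.
Proof.
rewrite count_flatten -map_comp sumnE big_map big_enum /= (bigD1 i)//= big1 ?addn0.
  by rewrite count_nseq /= eqxx mul1n.
by move=> j ji; rewrite count_nseq /= (negbTE ji) mul0n.
Qed.

Lemma multiindex1 m (alpha : 'I_m -> nat) : (\sum_i alpha i = 1)%N ->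
  exists2 a, (forall i, alpha i = (i == a)) &
    forall (R : realType) n (f : 'rV[R]_m -> 'rV[R]_n), mpderiv alpha f = pderiv a f.
Proof.
rewrite -size_multiindex; move: (@count_multiindex _ alpha) (fun R n => @mpderivE R m n alpha).
case: (flatten _) => [|a [|]]//= ca da _; exists a => [i|R n f]; last by rewrite da.
by rewrite -ca addn0 eq_sym.
Qed.

Lemma multiindex2 m (alpha : 'I_m -> nat) : (\sum_i alpha i = 2)%N ->
  exists a b, (forall i, alpha i = (i == a) + (i == b))%N /\
    forall (R : realType) n (f : 'rV[R]_m -> 'rV[R]_n),
      mpderiv alpha f = pderiv a (pderiv b f).
Proof.
rewrite -size_multiindex; move: (@count_multiindex _ alpha) (fun R n => @mpderivE R m n alpha).
case: (flatten _) => [|a [|b [|]]]//= ca da _; exists a, b; split=> [i|R n f]; last by rewrite da.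
by rewrite -ca addn0 eq_sym [b == i]eq_sym.
Qed.

Lemma prod_expr_eq (A : comNzRingType) m (h : 'I_m -> A) a :
  \prod_i h i ^+ (i == a) = h a.
Proof. by rewrite (bigD1 a)//= eqxx expr1 big1 ?mulr1// => i /negbTE->; rewrite expr0. Qed.

Lemma multiindex2_eq m (a b i j : 'I_m) :
  (forall k, (k == i) + (k == j) = (k == a) + (k == b))%N ->
  (i, j) \in [:: (a, b); (b, a)].
Proof.
move=> E; rewrite !inE !xpair_eqE; have [ia|ia] := eqVneq i a.
  move: (E b); rewrite ia eqxx => /addnI; rewrite [b == j]eq_sym.
  by case: (j == b) => //= _.
move: (E a); rewrite eqxx [a == i]eq_sym (negbTE ia) [a == j]eq_sym.
have [ja|//] := eqVneq j a; have [//|ab] := eqVneq a b => _.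
move: (E b); rewrite ja eqxx eq_sym [b == a]eq_sym (negbTE ab) addn0.
by case: (i == b) => //=; rewrite orbT.
Qed.

(** The Taylor sum is split by degree, and the quadratic part is reindexed by ordered pairs of
    directions. A mixed multi-index has alpha! = 1 and comes from two pairs, a pure one has alpha! =
    2 and comes from one pair; either way each pair receives weight 1/2. [sym] makes the two pairs
    of a mixed index contribute equally. *)
Lemma weil_prolong2E (R : realType) (A : comAlgType R) (pi : A -> R) m n
    (f : 'rV[R]_m -> 'rV[R]_n) (a : 'rV[A]_m) (x := map_mx pi a)
    (H := a - map_mx (in_alg A) x) :
  (forall i j, pderiv i (pderiv j f) x = pderiv j (pderiv i f) x) ->
  weil_prolong pi 2 f a =
    map_mx (in_alg A) (f x) + \sum_i H 0 i *: map_mx (in_alg A) (pderiv i f x)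
    + (2^-1)%:A *: \sum_i \sum_j
        (H 0 i * H 0 j) *: map_mx (in_alg A) (pderiv i (pderiv j f) x).
Proof.
move=> sym; rewrite /weil_prolong -/x -/H.
pose T (alpha : {ffun 'I_m -> 'I_3}) := (\prod_i H 0 i ^+ alpha i) *:
  map_mx (in_alg A) ((\prod_i (alpha i)`!)%:R^-1 *: mpderiv (fun i => alpha i) f x).
rewrite (eq_bigr T)//.
pose D (alpha : {ffun 'I_m -> 'I_3}) := (\sum_i alpha i)%N.
rewrite (bigID (fun alpha => D alpha == 2)) /= addrC.
congr (_ + _); last first.
  rewrite (eq_bigl (fun alpha => D alpha == 2)); last first.
    by move=> alpha; rewrite -/(D alpha); case: (D alpha) => [|[|[|]]].
  pose U (p : 'I_m * 'I_m) :=
    (H 0 p.1 * H 0 p.2) *: map_mx (in_alg A) (pderiv p.1 (pderiv p.2 f) x).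
  (* The multi-index of an ordered pair; its fibre over [e (b, c)] is {(b, c), (c, b)}. The entries
     are at most 2, so [inord] does not truncate. *)
  pose e (p : 'I_m * 'I_m) : {ffun 'I_m -> 'I_3} :=
    [ffun k => inord ((k == p.1) + (k == p.2))].
  have eE p k : e p k = ((k == p.1) + (k == p.2))%N :> nat.
    by rewrite ffunE inordK//; case: eqP; case: eqP.
  rewrite (pair_bigA _ (fun i j => U (i, j))) /=.
  rewrite (partition_big e (fun alpha => D alpha == 2)) /=; last first.
    move=> p _; apply/eqP; rewrite /D (eq_bigr (fun k => (k == p.1) + (k == p.2)))%N//.
    by rewrite big_split/= -!big_mkcond /= !big_pred1_eq.
  rewrite scaler_sumr; apply: eq_bigr => alpha /eqP /multiindex2[b [c [ab dab]]].
  have alphaE : alpha = e (b, c) by apply/ffunP => k; apply/ord_inj; rewrite ab eE.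
  have prodH : \prod_k H 0 k ^+ alpha k = H 0 b * H 0 c.
    under eq_bigr do rewrite ab exprD.
    by rewrite big_split/= !prod_expr_eq.
  (* Read [(b == c).+1] as 2 on the diagonal and 1 off it. *)
  have prodf : (\prod_k (alpha k)`!)%N = (b == c).+1.
    rewrite (bigD1 b)//= ab eqxx [X in (_ * X)%N]big1 ?muln1; first by case: (b == c).
    by move=> k /negbTE kb; rewrite ab kb; case: (k == c).
  have Tal : T alpha = ((b == c).+1%:R^-1 : R)%:A *: U (b, c).
    rewrite /T dab prodH prodf /U /= [RHS]scalerA [in RHS]mulrC -[RHS]scalerA; congr (_ *: _).
    by apply/matrixP => i j; rewrite !mxE -scalerAl mul1r scalerA.
  have Usym : U (c, b) = U (b, c) by rewrite /U /= sym mulrC.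
  rewrite (eq_bigl (mem [:: (b, c); (c, b)])); last first.
    move=> [i j] /=; rewrite alphaE; apply/eqP/idP => [E|].
      by apply: multiindex2_eq => k; rewrite -(eE (i, j)) -(eE (b, c)) E.
    rewrite !inE => /orP[/eqP[-> ->]//|/eqP[-> ->]].
    by apply/ffunP => k; apply/ord_inj; rewrite !eE addnC.
  rewrite Tal; have [bc|bc] := eqVneq b c.
    rewrite (eq_bigl (pred1 (b, c))); last by move=> p; rewrite !inE bc orbb.
    by rewrite big_pred1_eq.
  have uq : uniq [:: (b, c); (c, b)] by rewrite /= inE xpair_eqE (negbTE bc).
  rewrite -(big_uniq _ uq) big_cons big_seq1 Usym /= invr1 !scale1r.
  rewrite -mulr2n -[U _ *+ 2]scaler_nat scalerA -scalerAl mul1r.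
  have -> : 2^-1 *: (2%:R : A) = 1.
    have -> : 2%:R = (2%:R : R)%:A :> A by rewrite scaler_nat.
    by rewrite scalerA mulVf ?scale1r// pnatr_eq0.
  exact/esym/scale1r.
rewrite (bigID (fun alpha => D alpha == 1)) /= addrC; congr (_ + _); last first.
  rewrite (eq_bigl (fun alpha => D alpha == 1)); last first.
    by move=> alpha; rewrite -/(D alpha); case: (D alpha) => [|[|[|]]].
  pose e (p : 'I_m) : {ffun 'I_m -> 'I_3} := [ffun k => inord (k == p)].
  have eE p k : e p k = (k == p) :> nat by rewrite ffunE inordK//; case: eqP.
  rewrite [RHS](partition_big e (fun alpha => D alpha == 1)) /=; last first.
    move=> p _; apply/eqP; rewrite /D (eq_bigr (fun k => (k == p) : nat)) => [|k _]//.
    by rewrite -big_mkcond /= big_pred1_eq.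
  apply: eq_bigr => alpha /eqP /multiindex1[b ab dab].
  rewrite (eq_bigl (pred1 b)); last first.
    move=> p /=; apply/eqP/eqP => [E|->].
      by apply/eqP; rewrite eq_sym; move: (eE p b) (ab b); rewrite E eqxx => ->; case: (_ == _).
    by apply/ffunP => k; apply/ord_inj; rewrite ab eE.
  have prodH : \prod_k H 0 k ^+ alpha k = H 0 b.
    by under eq_bigr do rewrite ab; rewrite prod_expr_eq.
  have prodf : (\prod_k (alpha k)`!)%N = 1%N.
    by apply: big1 => k _; rewrite ab; case: (_ == _).
  by rewrite big_pred1_eq /T dab prodH prodf invr1 scale1r.
have zE (alpha : {ffun 'I_m -> 'I_3}) : (D alpha == 0)%N = (alpha == [ffun=> ord0]).
  rewrite /D sum_nat_eq0; apply/forallP/eqP => [E|-> i]; last by rewrite ffunE.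
  by apply/ffunP => i; apply/ord_inj; rewrite ffunE; apply/eqP; move: (E i).
rewrite (eq_bigl (pred1 [ffun=> ord0])); last first.
  by move=> alpha /=; rewrite -/(D alpha) -zE; case: (D alpha) => [|[|[]]].
rewrite big_pred1_eq /T !big1 => [|i _|i _]; try by rewrite ffunE.
rewrite scale1r invr1 scale1r mpderivE (size0nil (s := flatten _))//.
by rewrite size_multiindex big1// => i _; rewrite ffunE.
Qed.

(** * The order-two prolongation of exp over a commutative algebra with a scalar part *)

Section exponential_prolongation.
Variables (R : realType) (n : nat).
Let f (x : 'rV[R]_(n * n)) := mxvec (expmx (vec_mx x)).
Let E (i : 'I_(n * n)) : 'M[R]_n := vec_mx (delta_mx 0 i).

Lemma pderiv_expmx i : pderiv i f = fun x => mxvec (dexpmx (vec_mx x) (E i)).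
Proof. by apply/funext => x; exact: derive_expmx. Qed.

Lemma pderiv2_expmx i j x :
  pderiv i (pderiv j f) x = mxvec (ddexpmx (vec_mx x) (E j) (E i)).
Proof. by rewrite pderiv_expmx; exact: derive_dexpmx. Qed.

Lemma dexpmx0r (X : 'M[R]_n) : dexpmx X 0 = 0.
Proof. by rewrite -(scale0r (0 : 'M[R]_n)) dexpmxZ !scale0r. Qed.

Lemma dexpmx_sum_delta (X B : 'M[R]_n) :
  \sum_i mxvec B 0 i *: dexpmx X (E i) = dexpmx X B.
Proof.
rewrite -[in RHS](mxvecK B) [mxvec B in RHS]row_sum_delta linear_sum /=.
rewrite (big_morph (dexpmx X) (dexpmxD X) (dexpmx0r X)).
by apply: eq_bigr => i _; rewrite linearZ dexpmxZ.
Qed.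

Variables (A : comAlgType R) (pi : {rmorphism A -> R}).
Hypothesis piK : forall c, pi c%:A = c.
Variable M : 'M[A]_n.

Let X := map_mx pi M.
Let H := M - map_mx (in_alg A) X.
Let ExpM : 'M[A]_n := vec_mx (weil_prolong pi 2 f (mxvec M)).

Lemma prolong_expmxE : ExpM = map_mx (in_alg A) (expmx X)
  + \sum_i mxvec H 0 i *: map_mx (in_alg A) (dexpmx X (E i))
  + (2^-1)%:A *: \sum_i \sum_j (mxvec H 0 i * mxvec H 0 j) *:
      map_mx (in_alg A) (ddexpmx X (E j) (E i)).
Proof.
rewrite /ExpM weil_prolong2E; last by move=> i j; rewrite !pderiv2_expmx ddexpmxC.
have -> : map_mx pi (mxvec M) = mxvec X by rewrite map_mxvec.
have -> : mxvec M - map_mx (in_alg A) (mxvec X) = mxvec H.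
  by rewrite [RHS]raddfB /= map_mxvec.
rewrite raddfD raddfD /=; congr (_ + _ + _).
- by rewrite /f mxvecK -map_vec_mx mxvecK.
- rewrite linear_sum; apply: eq_bigr => i _.
  by rewrite linearZ pderiv_expmx /= mxvecK -map_vec_mx mxvecK.
- rewrite linearZ /=; congr (_ *: _); rewrite linear_sum; apply: eq_bigr => i _.
  rewrite linear_sum; apply: eq_bigr => j _.
  by rewrite linearZ pderiv2_expmx /= mxvecK -map_vec_mx mxvecK.
Qed.

Lemma pi_nilpotent_part i j : pi (H i j) = 0.
Proof. by rewrite !mxE rmorphB /= piK subrr. Qed.

Lemma pi_mxvec_nilpotent_part i : pi (mxvec H 0 i) = 0.
Proof. by case/mxvec_indexP: i => i j; rewrite mxvecE pi_nilpotent_part. Qed.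

Lemma map_pi_prolong_expmx : map_mx pi ExpM = expmx X.
Proof.
apply/matrixP => i j; rewrite prolong_expmxE !mxE !rmorphD /= piK.
rewrite rmorphM !summxE !rmorph_sum !big1 ?mulr0 ?addr0// => k _.
  by rewrite summxE rmorph_sum big1// => l _; rewrite mxE !rmorphM pi_mxvec_nilpotent_part !mul0r.
by rewrite mxE rmorphM pi_mxvec_nilpotent_part mul0r.
Qed.

(** A derivation over [pi] kills real constants, and it kills the products of two entries of [H]
    since [pi] vanishes on [H]. Only the first-order Taylor term survives. *)
Lemma map_derivation_prolong_expmx (d : {additive A -> R}) :
  (forall c, d c%:A = 0) -> (forall a b, d (a * b) = d a * pi b + pi a * d b) ->
  map_mx d ExpM = dexpmx X (map_mx d M).
Proof.
move=> dC dM.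
have dH i : d (mxvec H 0 i) = mxvec (map_mx d M) 0 i.
  by case/mxvec_indexP: i => i j; rewrite !mxvecE !mxE raddfB /= dC subr0.
have scE a (B : 'M[R]_n) i j : (a *: map_mx (in_alg A) B) i j = a * (B i j)%:A by rewrite !mxE.
rewrite -dexpmx_sum_delta; apply/matrixP => i j.
rewrite prolong_expmxE !mxE !(raddfD d) /= dC add0r dM dC mul0r add0r piK.
rewrite !summxE !raddf_sum [X in _ + _ * X]big1 ?mulr0 ?addr0 => [|k _].
  apply: eq_bigr => k _; rewrite scE dM dC mulr0 addr0 piK dH.
  exact/esym/mxE.
rewrite summxE raddf_sum big1// => l _.
by rewrite scE !dM rmorphM !pi_mxvec_nilpotent_part !(mul0r, mulr0, addr0).
Qed.

(** At 0 the first derivative of exp is the identity and the second is the symmetrised product.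
    Expanding [M] in the basis [E], both orders of multiplication sum to [M *m M], which cancels the
    1/2 of the symmetrisation. *)
Lemma prolong_expmx_nilpotent : X = 0 ->
  ExpM = 1%:M + M + (2^-1)%:A *: (M *m M).
Proof.
move=> X0.
have HE : H = M by rewrite /H X0 map_mx0 subr0.
have ME : M = \sum_i mxvec M 0 i *: map_mx (in_alg A) (E i).
  rewrite -[LHS]mxvecK [mxvec M in LHS]row_sum_delta linear_sum; apply: eq_bigr => i _.
  by rewrite linearZ /= map_vec_mx map_delta_mx.
rewrite prolong_expmxE HE X0 expmx0 map_mx1.
under eq_bigr do rewrite dexpmx0.
rewrite -ME; congr (_ + _ *: _).
under eq_bigr do under eq_bigr do rewrite ddexpmx0.
pose P i j := (mxvec M 0 i * mxvec M 0 j) *: (map_mx (in_alg A) (E i) *m map_mx (in_alg A) (E j)).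
have PE : M *m M = \sum_i \sum_j P i j.
  rewrite [LHS](congr2 mulmx ME ME) mulmx_suml; apply: eq_bigr => i _.
  rewrite mulmx_sumr; apply: eq_bigr => j _.
  by rewrite -scalemxAr -scalemxAl scalerA mulrC.
transitivity ((2^-1)%:A *: (\sum_i \sum_j P i j + \sum_i \sum_j P j i)).
  rewrite -big_split scaler_sumr; apply: eq_bigr => i _.
  rewrite -big_split scaler_sumr; apply: eq_bigr => j _.
  rewrite map_mxZ map_mxD !map_mxM /P /= [mxvec M 0 j * _]mulrC -scalerDr !scalerA.
  by rewrite mulrC.
rewrite [X in _ + X]exchange_big /= -PE.
have -> : M *m M + M *m M = (2%:R : A) *: (M *m M) by rewrite scaler_nat mulr2n.
rewrite scalerA -scalerAl mul1r.
have -> : 2%:R = (2%:R : R)%:A :> A by rewrite scaler_nat.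
by rewrite scalerA mulVf ?pnatr_eq0// !scale1r.
Qed.

End exponential_prolongation.

(** * First-order coefficients in the Weil algebra *)

Section weil_coef.
Variable R : comNzRingType.

(* Coefficient of eps_i: the derivative at the origin of a representative; it
   vanishes on weil_ideal because each generator is a square. *)
Definition weil_coef (i : 'I_2) (a : weil_alg R) : R :=
  meval (fun=> 0) (mderiv i (repr (a : {ideal_quot weil_ideal R}))).

Lemma weil_coef_class i (P : mpoly 2 R) :
  weil_coef i (weil_class P) = meval (fun=> 0) (mderiv i P).
Proof.
apply/eqP; rewrite /weil_coef -subr_eq0 -rmorphB -mderivB; apply/eqP.
have /eqP := reprK (weil_class P : {ideal_quot weil_ideal R}).
rewrite -Quotient.idealrBE => /asboolP[S [T ->]].
rewrite !expr2 mderivD !mderivM !(rmorphD, rmorphM) /= /X1 /X2.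
by rewrite !mevalXU !(mul0r, mulr0, addr0).
Qed.

Lemma weil_coef_is_zmod_morphism i : zmod_morphism (weil_coef i).
Proof.
move=> a b; have [P ->] := weil_classP a; have [S ->] := weil_classP b.
by rewrite -rmorphB !weil_coef_class mderivB rmorphB.
Qed.

HB.instance Definition _ i :=
  GRing.isZmodMorphism.Build _ _ _ (weil_coef_is_zmod_morphism i).

Lemma weil_coefM i a b :
  weil_coef i (a * b) = weil_coef i a * scalar_part b + scalar_part a * weil_coef i b.
Proof.
have [P ->] := weil_classP a; have [S ->] := weil_classP b.
by rewrite -rmorphM !weil_coef_class !scalar_part_class mderivM rmorphD !rmorphM.
Qed.

Lemma in_weil_algE (c : R) : c%:A = weil_class (mpolyC 2 c) :> weil_alg R.
Proof. exact: mulr1. Qed.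

Lemma weil_coefC i c : weil_coef i c%:A = 0.
Proof. by rewrite in_weil_algE weil_coef_class mderivC rmorph0. Qed.

Lemma scalar_partC (c : R) : scalar_part (c%:A : weil_alg R) = c.
Proof. by rewrite in_weil_algE scalar_part_class mevalC. Qed.

Lemma mderivXU (i j : 'I_2) :
  meval (fun=> 0 : R) (mderiv i (mpolyX R (mnm1 j))) = (j == i)%:R.
Proof.
rewrite mderivX mevalZ mnm1E.
case: eqP => [->|_]; last by rewrite mul0r.
rewrite mul1r (_ : mnm_sub _ _ = mnm0); last by apply/mnmP => k; rewrite mnmBE mnm0E subnn.
by rewrite mpolyX0 rmorph1.
Qed.

Lemma weil_coef_eps1 i : weil_coef i (eps1 R) = (ord0 == i)%:R.
Proof. by rewrite weil_coef_class mderivXU. Qed.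

Lemma weil_coef_eps2 i : weil_coef i (eps2 R) = (ord_max == i)%:R.
Proof. by rewrite weil_coef_class mderivXU. Qed.

Lemma scalar_part_eps1 : scalar_part (eps1 R) = 0.
Proof. by rewrite scalar_part_class mevalXU. Qed.

Lemma scalar_part_eps2 : scalar_part (eps2 R) = 0.
Proof. by rewrite scalar_part_class mevalXU. Qed.

Lemma weil_class_eq0 P : P \in weil_ideal R -> weil_class P = 0.
Proof.
move=> PI; rewrite -(rmorph0 (@weil_class R)); apply/eqP.
by rewrite -Quotient.idealrBE subr0.
Qed.

Lemma eps1_sq : eps1 R ^+ 2 = 0.
Proof.
rewrite -rmorphXn; apply/weil_class_eq0/asboolP; exists 1, 0.
by rewrite mul1r mul0r addr0.
Qed.

Lemma eps2_sq : eps2 R ^+ 2 = 0.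
Proof.
rewrite -rmorphXn; apply/weil_class_eq0/asboolP; exists 0, 1.
by rewrite mul1r mul0r add0r.
Qed.

End weil_coef.

(** * Cross-product matrices and their commutators *)

Section cross_product_matrix.
Variable A : comNzRingType.
Implicit Types u v w : 'cV[A]_3.

Definition dot u v : A := (u^T *m v) 0 0.

Lemma dotE u v : dot u v = u (inord 0) 0 * v (inord 0) 0 + u (inord 1) 0 * v (inord 1) 0
  + u (inord 2) 0 * v (inord 2) 0.
Proof.
rewrite /dot mxE !big_ord_recr big_ord0 /= add0r !mxE.
by congr (u _ _ * v _ _ + u _ _ * v _ _ + u _ _ * v _ _); apply/ord_inj; rewrite inordK.
Qed.

Lemma cross_mxZ a u : cross_mx (a *: u) = a *: cross_mx u.
Proof.
apply/matrixP => -[[|[|[|//]]] ?] [[|[|[|//]]] ?]; rewrite !mxE /=; ring.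
Qed.

Lemma cross_mx0 : cross_mx (0 : 'cV[A]_3) = 0.
Proof. by rewrite -(scale0r (0 : 'cV[A]_3)) cross_mxZ scale0r. Qed.

Lemma cross_mx_inj : injective (@cross_mx A).
Proof.
move=> u v /matrixP E; apply/colP => i.
move: (E (inord 2) (inord 1)) (E (inord 0) (inord 2)) (E (inord 1) (inord 0)).
rewrite !mxE !inordK//= => E0 E1 E2.
rewrite -[i]inord_val; case: i => [[|[|[|//]]] ?] /=; assumption.
Qed.

(* u x (w x u) = (u . u) w - (u . w) u *)
Lemma cross_mx_double_comm u w (K := cross_mx u) (W := cross_mx w) :
  K *m (W *m K - K *m W) - (W *m K - K *m W) *m K = dot u u *: W - dot u w *: K.
Proof.
rewrite !dotE.
apply/matrixP => -[[|[|[|//]]] ?] [[|[|[|//]]] ?];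
  do 4? rewrite ?mxE ?big_ord_recr ?big_ord0 /=.
all: ring.
Qed.
End cross_product_matrix.

Lemma map_cross_mx (A B : comNzRingType) (g : {additive A -> B}) u :
  map_mx g (cross_mx u) = cross_mx (map_mx g u).
Proof.
by apply/matrixP => -[[|[|[|//]]] ?] [[|[|[|//]]] ?]; rewrite !mxE /= ?raddf0 ?raddfN.
Qed.

Lemma det_mx33 (A : comNzRingType) (g : nat -> nat -> A) :
  \det (\matrix_(i < 3, j < 3) g i j) =
    g 0%N 0%N * (g 1%N 1%N * g 2%N 2%N - g 1%N 2%N * g 2%N 1%N)
    - g 0%N 1%N * (g 1%N 0%N * g 2%N 2%N - g 1%N 2%N * g 2%N 0%N)
    + g 0%N 2%N * (g 1%N 0%N * g 2%N 1%N - g 1%N 1%N * g 2%N 0%N).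
Proof.
rewrite (expand_det_row _ ord0) !big_ord_recl big_ord0 /cofactor.
rewrite !(expand_det_row _ ord0) !big_ord_recl !big_ord0 /cofactor !det_mx11 !mxE /=.
rewrite /bump /=; ring.
Qed.

(** * The truncated exponential of a nilpotent cross-product matrix is a rotation *)

Section rotation.
Variables (A : comNzRingType) (h : A) (u : 'cV[A]_3).
Hypotheses (h2 : h * 2 = 1).
Hypothesis u3 : forall i j k, u i 0 * u j 0 * u k 0 = 0.
Let Phi := cross_mx u.

(** By Cayley-Hamilton, Phi^3 = - (u . u) Phi, whose entries are cubic in those of [u]. *)
Lemma cross_mx_cube : Phi *m Phi *m Phi = 0.
Proof.
have z i : dot u u * u i 0 = 0 by rewrite dotE !mulrDl !u3 !addr0.
rewrite (_ : _ *m _ = - dot u u *: Phi).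
  apply/matrixP => -[[|[|[|//]]] ?] [[|[|[|//]]] ?];
    by rewrite !mxE /= mulNr ?mulrN ?z ?mulr0 ?oppr0.
rewrite dotE.
apply/matrixP => -[[|[|[|//]]] ?] [[|[|[|//]]] ?];
  do 3? rewrite ?mxE ?big_ord_recr ?big_ord0 /=.
all: ring.
Qed.

(** Transposition changes the sign of Phi, so with Phi^3 = 0 the orthogonality product reduces to 1
    + (2 h - 1) Phi^2. The determinant is computed from explicit entries. *)
Lemma SO3_exp_truncated : 1%:M + Phi + h *: (Phi *m Phi) \in SO3 A.
Proof.
rewrite inE; split.
  have PT : Phi^T = - Phi.
    by apply/matrixP => -[[|[|[|//]]] ?] [[|[|[|//]]] ?]; rewrite !mxE /= ?oppr0 ?opprK.
  have trE : (1%:M + Phi + h *: (Phi *m Phi))^T = 1%:M - Phi + h *: (Phi *m Phi).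
    by rewrite !linearD /= linearZ /= trmx_mul trmx1 !PT mulmxN mulNmx opprK.
  rewrite trE; move: cross_mx_cube; set P := Phi *m Phi => PPhi.
  have PhiP : Phi *m P = 0 by rewrite /P mulmxA.
  have PP : P *m P = 0 by rewrite {2}/P mulmxA PPhi mul0mx.
  rewrite !(mulmxDl, mulmxDr) !mul1mx !mulmx1 !mulNmx -!scalemxAl -!scalemxAr.
  rewrite PPhi PhiP PP -/P !(scaler0, oppr0, addr0).
  transitivity (1%:M + (h * 2 - 1) *: P); last by rewrite h2 subrr scale0r addr0.
  move: (Phi) (P) => N P'; apply/matrixP => i j; rewrite !mxE; ring.
pose a := u (inord 0) 0; pose b := u (inord 1) 0; pose c := u (inord 2) 0.
(* These are the entries of 1 + Phi + h (u u^T - (u . u) 1). *)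
pose g i j : A := nth 0 (nth [::] [::
  [:: 1 - h * (b * b + c * c); h * (a * b) - c; h * (a * c) + b];
  [:: h * (a * b) + c; 1 - h * (a * a + c * c); h * (b * c) - a];
  [:: h * (a * c) - b; h * (b * c) + a; 1 - h * (a * a + b * b)]] i) j.
rewrite (_ : _ + _ = \matrix_(i < 3, j < 3) g i j).
  rewrite det_mx33 /g /=.
  have s4 : dot u u * dot u u = 0.
    by rewrite {2}dotE !mulrDr !mulrA dotE !mulrDl !u3 !(mul0r, addr0).
  (* the eigenvalues of Phi are 0 and the square roots of - dot u u *)
  transitivity (1 + (1 - h * 2) * dot u u + h * h * (dot u u * dot u u)).
    by rewrite dotE -/a -/b -/c; ring.
  by rewrite h2 subrr mul0r s4 mulr0 !addr0.
apply/matrixP => -[[|[|[|//]]] ?] [[|[|[|//]]] ?];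
  do 3? rewrite ?mxE ?big_ord_recr ?big_ord0 /=; rewrite -/a -/b -/c /g /=.
all: ring.
Qed.
End rotation.

(** * Coefficients of the prolonged exponential and the obstruction to an axis-angle form *)

Lemma Exp_weil_coef (R : realType) i (M : 'M[weil_alg R]_3) :
  map_mx (weil_coef i) (Exp_weil M)
  = dexpmx (map_mx (@scalar_part R) M) (map_mx (weil_coef i) M).
Proof.
exact: (map_derivation_prolong_expmx (@scalar_partC R) M
  (weil_coefC i) (weil_coefM i)).
Qed.

Lemma Exp_weil_scalar_part (R : realType) (M : 'M[weil_alg R]_3) :
  map_mx (@scalar_part R) (Exp_weil M) = expmx (map_mx (@scalar_part R) M).
Proof. exact: (map_pi_prolong_expmx (@scalar_partC R) M). Qed.

Lemma Exp_weil_nilpotent (R : realType) (M : 'M[weil_alg R]_3) :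
  map_mx (@scalar_part R) M = 0 ->
  Exp_weil M = 1%:M + M + (2^-1)%:A *: (M *m M).
Proof. exact: prolong_expmx_nilpotent. Qed.

Lemma Exp_weil_axis_angle_coef (R : realType) i theta (u : 'cV[weil_alg R]_3)
    (X := map_mx (@scalar_part R) (theta *: cross_mx u)) :
  u^T *m u = 1%:M -> expmx X = 1%:M ->
  map_mx (weil_coef i) (Exp_weil (theta *: cross_mx u)) =
    weil_coef i theta *: dexpmx X (cross_mx (map_mx (@scalar_part R) u)).
Proof.
move=> uu expX; rewrite Exp_weil_coef -/X.
set u0 := map_mx _ u; pose w := map_mx (weil_coef i) u.
have dotu : dot u u = 1 by rewrite /dot uu mxE.
have dot0 : dot u0 u0 = 1.
  move: (congr1 (@scalar_part R) dotu); rewrite rmorph1 !dotE !rmorphD !rmorphM.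
  by rewrite !mxE.
have dotw : dot u0 w = 0.
  (* The eps_i-coefficient of u . u = 1 reads 2 (u0 . w) = 0. *)
  move: (congr1 (weil_coef i) dotu); rewrite -(scale1r 1) weil_coefC !dotE.
  rewrite !raddfD /= !weil_coefM /u0 /w !mxE; lra.
have XE : X = scalar_part theta *: cross_mx u0.
  by rewrite /X map_mxZ map_cross_mx.
have -> : map_mx (weil_coef i) (theta *: cross_mx u)
    = weil_coef i theta *: cross_mx u0 + scalar_part theta *: cross_mx w.
  rewrite -!map_cross_mx; apply/matrixP => k l; rewrite !mxE.
  by rewrite weil_coefM.
(* With u0 . u0 = 1 and u0 . w = 0, the double commutator returns [cross_mx w]. The scalar angle
   enters only as a common factor and is never divided by, so angle 0 needs no separate
   treatment. *)
pose V := cross_mx w *m cross_mx u0 - cross_mx u0 *m cross_mx w.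
have <- : X *m V - V *m X = scalar_part theta *: cross_mx w.
  rewrite XE -scalemxAl -scalemxAr -scalerBr cross_mx_double_comm.
  by rewrite dot0 dotw scale1r scale0r subr0.
by rewrite dexpmxD dexpmxZ dexpmx_comm expX mul1mx mulmx1 subrr addr0.
Qed.

Theorem theorem8p1 (R : realType) (p q : 'cV[R]_3) (hpq : free [:: p; q]) :
  let phi : 'cV[weil_alg R]_3 :=
    eps1 R *: map_mx (in_alg (weil_alg R)) p + eps2 R *: map_mx (in_alg (weil_alg R)) q in
  let Q : 'M[weil_alg R]_3 := Exp_weil (cross_mx phi) in
  SO3 (weil_alg R) Q /\
  ~ (exists (theta : weil_alg R) (u : 'cV[weil_alg R]_3),
       u^T *m u = 1%:M /\ Q = Exp_weil (theta *: cross_mx u)).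
Proof.
move=> phi Q.
have phi0 : map_mx (@scalar_part R) (cross_mx phi) = 0.
  rewrite map_cross_mx (_ : map_mx _ phi = 0) ?cross_mx0//.
  apply/matrixP => i j; rewrite /phi !mxE raddfD /= !rmorphM /=.
  by rewrite scalar_part_eps1 scalar_part_eps2 !mul0r addr0.
have coef_phi i : map_mx (weil_coef i) phi = (ord0 == i)%:R *: p + (ord_max == i)%:R *: q.
  apply/matrixP => k l; rewrite /phi !mxE raddfD /= (weil_coefM i (eps1 R)) (weil_coefM i (eps2 R)).
  rewrite scalar_part_eps1 scalar_part_eps2 !mul0r !addr0 !scalar_partC.
  by rewrite weil_coef_eps1 weil_coef_eps2.
split.
  rewrite /Q Exp_weil_nilpotent//; apply/set_mem/SO3_exp_truncated.
    have -> : 2 = (2%:R : R)%:A :> weil_alg R by rewrite scaler_nat.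
    by rewrite -scalerAl mul1r scalerA mulVf ?scale1r// pnatr_eq0.
  move=> i j k; rewrite /phi !mxE.
  set e1 := eps1 R; set e2 := eps2 R.
  set a1 := in_alg _ (p i 0); set a2 := in_alg _ (p j 0); set a3 := in_alg _ (p k 0).
  set b1 := in_alg _ (q i 0); set b2 := in_alg _ (q j 0); set b3 := in_alg _ (q k 0).
  move: a1 a2 a3 b1 b2 b3 => a1 a2 a3 b1 b2 b3.
  (* Every cubic monomial in two variables contains the square of one of them. *)
  transitivity (e1 ^+ 2 * (e1 * a1 * a2 * a3 + e2 * (a1 * a2 * b3 + a1 * b2 * a3 + b1 * a2 * a3))
    + e2 ^+ 2 * (e2 * b1 * b2 * b3 + e1 * (a1 * b2 * b3 + b1 * a2 * b3 + b1 * b2 * a3))).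
    by ring.
  by rewrite eps1_sq eps2_sq !mul0r addr0.
move=> [theta [u [uu QE]]].
set X := map_mx (@scalar_part R) (theta *: cross_mx u).
(* The scalar part of [Q] is exp 0 = 1. This is all that is used about the branch of the angle. *)
have expX : expmx X = 1%:M.
  by rewrite -Exp_weil_scalar_part -QE Exp_weil_scalar_part phi0 expmx0.
set L := dexpmx X (cross_mx (map_mx (@scalar_part R) u)).
(* [L] does not depend on [i]: both first-order coefficients of [phi] lie on a single line. *)
have coefE i : cross_mx (map_mx (weil_coef i) phi) = weil_coef i theta *: L.
  rewrite -(Exp_weil_axis_angle_coef i uu expX) -QE Exp_weil_coef phi0 dexpmx0.
  by rewrite map_cross_mx.
have max0 : (ord_max == ord0 :> 'I_2) = false by [].
have := coefE ord0; have := coefE ord_max.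
rewrite !coef_phi !eqxx [ord0 == _]eq_sym max0 !scale0r !scale1r add0r addr0.
set b := weil_coef ord_max theta; set a := weil_coef ord0 theta => qE pE.
move: hpq; rewrite free_cons span_seq1 => /andP[/negP pq].
rewrite seq1_free => q0.
have b0 : b != 0.
  apply: contra q0 => /eqP b0; apply/eqP/cross_mx_inj.
  by rewrite qE b0 scale0r cross_mx0.
(* Eliminating [L] from [p] = a L and [q] = b L gives p = (a / b) q, against linear independence. *)
apply: pq; apply/vlineP; exists (a / b); apply: cross_mx_inj.
by rewrite cross_mxZ pE qE scalerA divfK.
Qed.
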